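(* Let $P$ and $\widetilde P$ be polygonal graphs in $\mathbb{R}^3$, having the same topological vertices, and homeomorphic to each other. Suppose that every vertex of $P$ is also a vertex of $\widetilde P$, i.e. $\widetilde P$ is a refinement of $P$. Then for almost all $e\in S^2$, the multiplicity satisfies $\mu_{\widetilde P}(e)\ge\mu_P(e)$. As a consequence, $\mathrm{NTC}(\widetilde P)\ge\mathrm{NTC}(P)$.
   Context: A polygonal graph is a connected finite graph in $\mathbb{R}^3$ whose edges are straight segments. The degree $d(q)$ of a vertex $q$ is the number of edges which have $q$ as an endpoint; topological vertices are those of degree $\ne2$. $\widetilde P$ is said to be a refinement of $P$ provided the set of vertices of $P$ is a subset of the set of vertices of $\widetilde P$. Net total curvature: for a vertex $q$ of degree $d$ with unit vectors $T_1,\dots,T_d$ at $q$ pointing into the edges ending at $q$, $\mathrm{ntc}(q)=\frac14\int_{S^2}\big[\sum_{i=1}^d\chi_i(e)\big]^+dA_{S^2}(e)$, where $[\cdot]^+$ is the positive part, $\chi_i=-1$ on the hemisphere centered at $T_i$ and $\chi_i=+1$ on the opposite hemisphere (up to measure zero). $\mathrm{NTC}(P)=\sum_q\mathrm{ntc}(q)$ over all vertices $q$ of $P$. Multiplicity: the double of $P$ has the same vertices and two copies of each edge; a parameterization of the double is a mapping from a (not necessarily connected) 1-manifold without boundary which covers each edge of the double once, so that $d(q)$ points lie over each vertex $q$. Put $\mathrm{nlm}_P(e,q)=\frac12[\mathrm{lmax}(e,q)-\mathrm{lmin}(e,q)]$, where $\mathrm{lmax}(e,q)$ and $\mathrm{lmin}(e,q)$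 are the numbers of local maxima and local minima of $\langle e,\cdot\rangle$ along the parameterization at the points over $q$; this is independent of the parameterization. For almost all $e\in S^2$, $\mu_P(e)=\sum_q\max(\mathrm{nlm}_P(e,q),0)$, summed over all vertices $q$ of $P$.
   Formalization: The homeomorphism between P and P~ is required to fix every vertex of P; with an arbitrary homeomorphism the claim fails (closed polygons a-c-b-d and a-b-c-d on four non-coplanar points have the same vertices, but multiplicities 2 and 1 on an open set of directions). *)

(* Defs.v *)
From HB Require Import structures.
From mathcomp Require Import all_boot all_order all_algebra finmap.
From mathcomp Require Import all_classical all_reals all_analysis.
From mathcomp Require Import measurable_realfun ring lra.

Set Implicit Arguments.
Unset Strict Implicit.
Unset Printing Implicit Defensive.

Import Order.TTheory GRing.Theory Num.Theory numFieldNormedType.Exports.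
Local Open Scope classical_set_scope.
Local Open Scope ring_scope.

(* As a product of copies of R, this type carries both the Borel sigma-algebra
   and the topology; its library norm is the sup norm, hence norm3 below. *)
Notation R3 R := (R * R * R)%type.

Section Euclidean.
Variable R : realType.
Implicit Types x y e : R3 R.

Definition dot x y : R := x.1.1 * y.1.1 + x.1.2 * y.1.2 + x.2 * y.2.
Definition norm3 x : R := Num.sqrt (dot x x).
Definition normalize x : R3 R := (norm3 x)^-1 *: x.

Definition S2 : set (R3 R) := [set e | norm3 e = 1].

(* Lebesgue measure on R itself instead of its alias measurableTypeR R, so that
   products of it are measures on R3 R. *)
Definition leb : set R -> \bar R := @lebesgue_measure R.

Let leb0 : leb set0 = 0%E. Proof. exact: measure0. Qed.

Let leb_ge0 A : (0 <= leb A)%E. Proof. exact: measure_ge0. Qed.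

Let leb_sigma_additive : semi_sigma_additive leb.
Proof. exact: (@measure_semi_sigma_additive _ _ _ (@lebesgue_measure R)). Qed.

HB.instance Definition _ := isMeasure.Build _ R R leb
  leb0 leb_ge0 leb_sigma_additive.

Let leb_sigma_finite : sigma_finite setT leb.
Proof. exact: (@sigma_finiteT _ _ _ (@lebesgue_measure R)). Qed.

HB.instance Definition _ := @Measure_isSigmaFinite.Build _ R R leb
  leb_sigma_finite.

Definition volume : {measure set (R3 R) -> \bar R} := (leb \x leb \x leb)%E.

Definition punctured_ball : set (R3 R) := [set x | 0 < norm3 x <= 1].

(* The area measure of S^2, carried by S^2: the area of A is 3 times the volume
   of the cone {r e | e in A, 0 < r <= 1}. *)
Definition sphere_area (A : set (R3 R)) : \bar R :=
  (3%:E * volume (normalize @^-1` A `&` punctured_ball))%E.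

Lemma measurable_dot (f g : R3 R -> R3 R) : measurable_fun setT f ->
  measurable_fun setT g -> measurable_fun setT (fun x => dot (f x) (g x)).
Proof.
move=> mf mg; rewrite /dot.
have h1 (k : R3 R -> R3 R) : measurable_fun setT k ->
    measurable_fun setT (fun x => (k x).1.1).
  by move=> mk; apply: measurableT_comp => //; apply: measurableT_comp.
have h2 (k : R3 R -> R3 R) : measurable_fun setT k ->
    measurable_fun setT (fun x => (k x).1.2).
  by move=> mk; apply: measurableT_comp => //; apply: measurableT_comp.
have h3 (k : R3 R -> R3 R) : measurable_fun setT k ->
    measurable_fun setT (fun x => (k x).2).
  by move=> mk; apply: measurableT_comp.
by apply: measurable_funD; [apply: measurable_funD|];
  apply: measurable_funM; auto.
Qed.

Lemma measurable_norm3 : measurable_fun setT norm3.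
Proof.
apply: (@measurableT_comp _ _ _ _ _ _ (@Num.sqrt R)); last first.
  by apply: measurable_dot; exact: measurable_id.
by apply: continuous_measurable_fun; exact: sqrt_continuous.
Qed.

Lemma measurable_normalize : measurable_fun setT normalize.
Proof.
have mi : measurable_fun setT (fun x : R3 R => (norm3 x)^-1).
  under eq_fun do rewrite -powR_inv1 ?sqrtr_ge0//.
  exact: (measurableT_comp (measurable_powR (-1)) measurable_norm3).
apply: measurable_fun_pair; first apply: measurable_fun_pair => /=;
  apply: measurable_funM => //; do ?exact: measurable_snd;
  by apply: measurableT_comp.
Qed.

Lemma measurable_punctured_ball : measurable punctured_ball.
Proof.
rewrite (_ : punctured_ball = norm3 @^-1` `]0, 1]); last first.
  by apply/seteqP; split => x; rewrite /punctured_ball /= in_itv.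
by rewrite -[X in measurable X]setTI; apply: measurable_norm3.
Qed.

Let cone_measure : {measure set (R3 R) -> \bar R} :=
  mrestr volume measurable_punctured_ball.

Let sphere_area0 : sphere_area set0 = 0%E.
Proof. by rewrite /sphere_area preimage_set0 set0I measure0 mule0. Qed.

Let sphere_area_ge0 A : (0 <= sphere_area A)%E.
Proof. by rewrite /sphere_area mule_ge0. Qed.

Let sphere_area_sigma_additive : semi_sigma_additive sphere_area.
Proof.
have mnorm F : measurable F -> measurable (normalize @^-1` F).
  by move=> mF; rewrite -[X in measurable X]setTI; exact: measurable_normalize.
move=> F mF tF mUF.
rewrite [X in X @ \oo --> _](_ : _ = fun n =>
    (3%:E * \sum_(0 <= i < n) cone_measure (normalize @^-1` F i))%E); last first.
  by apply/funext => n; rewrite ge0_sume_distrr.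
apply: cvgeZl => //; rewrite preimage_bigcup.
apply: (@measure_semi_sigma_additive _ _ _ cone_measure) => [n||].
- exact: mnorm.
- apply/trivIsetP => /= i j _ _ ij; rewrite -preimage_setI.
  by move/trivIsetP : tF => /(_ _ _ _ _ ij) ->//; rewrite preimage_set0.
- by rewrite -preimage_bigcup; exact: mnorm.
Qed.

HB.instance Definition _ := isMeasure.Build _ _ _ sphere_area
  sphere_area0 sphere_area_ge0 sphere_area_sigma_additive.

End Euclidean.

(* An edge is given by its two endpoints: as a point set it is the segment
   joining them. *)
Record polygonal_graph (R : realType) := PolygonalGraph {
  vertices : {fset R3 R};
  edges : {fset {fset R3 R}};
  edge_endpoints : forall a, a \in edges -> #|` a| = 2%N /\ (a `<=` vertices)%fset;
  graph_connected : forall u v, u \in vertices -> v \in vertices ->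
    exists p, path [rel x y | [fset x; y]%fset \in edges] u p /\ last u p = v
}.

Section Graph.
Variable R : realType.
Implicit Types (P : polygonal_graph R) (q u v e : R3 R).

Definition degree P q : nat := #|` [fset a in edges P | q \in a]%fset|.

Definition topological_vertices P : {fset R3 R} :=
  [fset q in vertices P | degree P q != 2%N]%fset.

Definition refinement P' P : Prop := (vertices P `<=` vertices P')%fset.

Definition vertex_point q : {ptws R3 R -> R} := fun x => (x == q)%:R.

Definition edge_point u v (t : R) : {ptws R3 R -> R} :=
  fun x => (1 - t) * vertex_point u x + t * vertex_point v x.

(* The underlying topological space of the graph, as a one-dimensional
   simplicial complex in barycentric coordinates indexed by the points of R^3.
   Different edges are not required to have disjoint interiors in R^3; when they
   do, this space is homeomorphic to the union of the edges, see
   realization_embedded. *)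
Definition realization P : set {ptws R3 R -> R} :=
  [set vertex_point q | q in [set` vertices P]] `|`
  [set w | exists u v t,
     [/\ [fset u; v]%fset \in edges P, 0 <= t <= 1 & w = edge_point u v t]].

Definition homeomorphism (X Y : topologicalType) (A : set X) (B : set Y)
    (f : X -> Y) : Prop :=
  [/\ set_bij A B f, {within A, continuous f} &
      exists2 g : Y -> X, {within B, continuous g} & {in A, cancel f g}].

Definition neighbors P q : {fset R3 R} :=
  [fset v in vertices P | [fset q; v] \in edges P]%fset.

(* -1 on the open hemisphere centered at T, 1 on the opposite one, 0 on the
   equator between them, which is a null set. *)
Definition chi (T e : R3 R) : R := - Num.sg (dot e T).

Definition ntc P q : \bar R :=
  ((4^-1)%:E * \int[@sphere_area R]_(e in @S2 R)
     (Num.max (\sum_(v <- neighbors P q) chi (normalize (v - q)) e) 0)%:E)%E.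

Definition NTC P : \bar R := (\sum_(q <- vertices P) ntc P q)%E.

(* An arc (u, v, b) runs along copy b of the edge {u, v} of the double of P,
   from u to v. *)
Definition arc : Type := R3 R * R3 R * bool.
Definition source (d : arc) : R3 R := d.1.1.
Definition target (d : arc) : R3 R := d.1.2.
Definition double_edge (d : arc) : {fset R3 R} * bool :=
  ([fset source d; target d]%fset, d.2).

(* A compact 1-manifold without boundary is a finite disjoint union of circles;
   each circle is mapped to a cyclic sequence of consecutive arcs. The points
   of the manifold over a vertex q correspond to the arcs with target q; as each
   edge of the double is covered once, there are degree P q of them. *)
Definition parameterization P (M : seq (seq arc)) : Prop :=
  (forall c, c \in M -> cycle (fun d d' => target d == source d') c) /\
  perm_eq (map double_edge (flatten M))
    [seq (a, b) | a <- edges P, b <- [:: false; true]].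

(* The parameterization in the neighborhood t = 0 of a point over q, which it
   reaches from u and leaves towards v. *)
Definition passage u q v (t : R) : R3 R :=
  if t <= 0 then q - t *: (u - q) else q + t *: (v - q).

Definition local_max (f : R -> R) : Prop := \forall t \near (0 : R), f t <= f 0.
Definition local_min (f : R -> R) : Prop := \forall t \near (0 : R), f 0 <= f t.

Definition height (c : seq arc) e (d : arc) (t : R) : R :=
  dot e (passage (source d) (target d) (target (next c d)) t).

Definition lmax (M : seq (seq arc)) e q : nat :=
  (\sum_(c <- M)
     count (fun d => (target d == q) && `[< local_max (height c e d) >]) c)%N.

Definition lmin (M : seq (seq arc)) e q : nat :=
  (\sum_(c <- M)
     count (fun d => (target d == q) && `[< local_min (height c e d) >]) c)%N.

Definition nlm M e q : R := ((lmax M e q)%:R - (lmin M e q)%:R) / 2.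

Definition multiplicity P M e : R :=
  \sum_(q <- vertices P) Num.max (nlm M e q) 0.

End Graph.

Lemma compact_homeomorphism (X Y : topologicalType) (A : set X) (B : set Y)
    (f : X -> Y) (x0 : X) : hausdorff_space Y -> compact A ->
  {within A, continuous f} -> set_bij A B f -> homeomorphism A B f.
Proof.
move=> hY cA cf bf; split => //; have [fAB /(_ _ _)fI fS] := bf.
have /choice[g gP] : forall y, exists x, B y -> A x /\ f x = y.
  move=> y; have [/fS[x Ax <-]|nBy] := pselect (B y); [by exists x|by exists x0].
have gK : {in A, cancel f g}.
  move=> x xA; have Ax := set_mem xA; have [Agfx e] := gP (f x) (fAB _ Ax).
  by apply: fI => //; rewrite inE.
exists g => //; apply/subspace_continuousP => y By U.
rewrite nbhsE => -[V [oV Vgy] VU].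
pose K := f @` (A `&` ~` V).
have cK : closed K.
  apply: compact_closed => //; apply: continuous_compact.
    by apply: continuous_subspaceW cf; exact: subIsetl.
  by apply: compact_closedI => //; exact: open_closedC.
have nK : (~` K) y.
  by move=> [x [Ax nVx] fxy]; apply: nVx; rewrite -[x]gK ?inE// fxy.
have /filterS : nbhs y (~` K) by apply: open_nbhs_nbhs; split => //; exact: closed_openC.
apply => z nKz Bz; apply: VU; apply: contrapT => nVgz; apply: nKz.
by have [Agz fgz] := gP z Bz; exists (g z).
Qed.

Section Realization.
Variable R : realType.
Implicit Types (P : polygonal_graph R) (q u v : R3 R).

Definition segment u v : set (R3 R) :=
  [set x | exists2 t : R, 0 <= t <= 1 & x = (1 - t) *: u + t *: v].

Definition embedded P : Prop :=
  (forall u v u' v', [fset u; v]%fset \in edges P ->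
     [fset u'; v']%fset \in edges P -> [fset u; v]%fset <> [fset u'; v']%fset ->
     forall x, segment u v x -> segment u' v' x ->
     x \in [fset u; v]%fset /\ x \in [fset u'; v']%fset) /\
  (forall u v q, [fset u; v]%fset \in edges P -> q \in vertices P ->
     segment u v q -> q \in [fset u; v]%fset).

Definition carrier P : set (R3 R) :=
  [set` vertices P] `|`
  [set x | exists u v, [fset u; v]%fset \in edges P /\ segment u v x].

Lemma edge_point0 u v : edge_point u v 0 = vertex_point u.
Proof. by apply/funext => x; rewrite /edge_point subr0 mul1r mul0r addr0. Qed.
Lemma edge_point1 u v : edge_point u v 1 = vertex_point v.
Proof. by apply/funext => x; rewrite /edge_point subrr mul1r mul0r add0r. Qed.
Lemma edge_pointC u v t : edge_point u v t = edge_point v u (1 - t).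
Proof. by apply/funext => x; rewrite /edge_point; ring. Qed.

Lemma edge_neq P u v : [fset u; v]%fset \in edges P -> u != v.
Proof.
move=> /edge_endpoints[+ _]; rewrite cardfs2; by case: (u != v).
Qed.

Lemma edge_vertices P u v : [fset u; v]%fset \in edges P ->
  u \in vertices P /\ v \in vertices P.
Proof.
by move=> /edge_endpoints[_ /fsubsetP s]; split; apply: s; rewrite !inE eqxx ?orbT.
Qed.

Definition place P (w : {ptws R3 R -> R}) : R3 R :=
  \sum_(x <- vertices P) w x *: x.

Lemma place_vertex P q : q \in vertices P -> place P (vertex_point q) = q.
Proof.
move=> qV; rewrite /place (big_fsetD1 q)//= /vertex_point eqxx scale1r.
by rewrite big_seq big1 ?addr0// => x; rewrite !inE => /andP[/negPf-> _]; rewrite scale0r.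
Qed.

Lemma place_edge P u v t : [fset u; v]%fset \in edges P ->
  place P (edge_point u v t) = (1 - t) *: u + t *: v.
Proof.
move=> /edge_vertices[uV vV].
transitivity ((1 - t) *: place P (vertex_point u) + t *: place P (vertex_point v)).
  rewrite /place !scaler_sumr -big_split/=.
  by apply: eq_bigr => x _; rewrite !scalerA -scalerDl.
by rewrite !place_vertex.
Qed.

Lemma place_continuous P : continuous (place P).
Proof.
have h (x : R3 R) : continuous (fun w : {ptws R3 R -> R} => w x *: x).
  have sc : continuous (fun a : R => a *: x) by exact: (@scalel_continuous R (R3 R) x).
  move=> w; apply: (@continuous_comp {ptws R3 R -> R} R (R3 R) (fun w => w x) (fun a => a *: x)).
    exact: (@proj_continuous (R3 R) (fun=> R) x w).
  exact: sc.
pose F (s : seq (R3 R)) (w : {ptws R3 R -> R}) : R3 R := \sum_(x <- s) w x *: x.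
suff cF s : continuous (F s) by exact: cF.
elim: s => [|x s IHs].
  have -> : F [::] = cst 0 by apply/funext => w; rewrite /F big_nil.
  exact: (@cst_continuous {ptws R3 R -> R} (R3 R) 0).
have -> : F (x :: s) = (fun w => w x *: x + F s w).
  by apply/funext => w; rewrite /F big_cons.
move=> w; exact: (@continuousD R (R3 R) {ptws R3 R -> R} (fun w => w x *: x)
  (F s) w (h x w) (IHs w)).
Qed.

Lemma edge_point_continuous u v : continuous (edge_point u v).
Proof.
move=> t; apply/cvg_sup => x A; rewrite nbhsE => -[_ [[B oB <-] /= Bt] BA].
have ct : continuous (fun t : R => edge_point u v t x).
  by rewrite /edge_point => s; apply: cvgD; apply: cvgM;
    [apply: cvgB; [exact: cvg_cst|exact: cvg_id]|exact: cvg_cst|exact: cvg_id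
    |exact: cvg_cst].
have : nbhs (edge_point u v t x) B by exact: open_nbhs_nbhs.
move=> nB; have : nbhs t ((fun s => edge_point u v s x) @^-1` B) by exact: ct.
by apply: (@filterS R (nbhs t)) => s /= Bs; exact: BA.
Qed.

Lemma realizationE P : realization P =
  (\big[setU/set0]_(q <- vertices P) [set vertex_point q]) `|`
  \big[setU/set0]_(p <- [seq (u, v) | u <- vertices P, v <- vertices P]
     | [fset p.1; p.2]%fset \in edges P) (edge_point p.1 p.2 @` `[0, 1]).
Proof.
congr (_ `|` _).
  rewrite -bigcup_seq; apply/seteqP; split => w /=.
    by move=> [q qV <-]; exists q.
  by move=> [q /= qV ->]; exists q.
rewrite -bigcup_seq_cond; apply/seteqP; split => w /=.
  move=> [u [v [t [uvE t01 ->]]]]; exists (u, v) => /=; last first.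
    by exists t => //; rewrite in_itv.
  by have [uV vV] := edge_vertices uvE; rewrite uvE andbT; apply/allpairsP; exists (u, v).
move=> [[u v] /= /andP[_ uvE] [t]]; rewrite in_itv /= => t01 <-.
by exists u, v, t.
Qed.

Lemma realization_compact P : compact (realization P).
Proof.
rewrite realizationE; apply: compactU; apply: bigsetU_compact => p _.
  exact: compact_set1.
apply: continuous_compact; last exact: segment_compact.
by apply: continuous_subspaceT; exact: edge_point_continuous.
Qed.

Lemma seg_inj u v (s t : R) : u != v ->
  (1 - s) *: u + s *: v = (1 - t) *: u + t *: v -> s = t.
Proof.
case: u => [[u1 u2] u3]; case: v => [[v1 v2] v3] uv [] e1 e2 e3.
apply/eqP; rewrite -subr_eq0; apply: contraNT uv => st.
have h (a b : R) : (1 - s) * a + s * b = (1 - t) * a + t * b -> a = b.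
  move=> e; have : (s - t) * (b - a) = 0 by nra.
  by move/eqP; rewrite mulf_eq0 (negPf st) subr_eq0 => /eqP.
by rewrite (h _ _ e1) (h _ _ e2) (h _ _ e3).
Qed.

Lemma edge_point_end P u v t : [fset u; v]%fset \in edges P ->
  (1 - t) *: u + t *: v \in [fset u; v]%fset ->
  edge_point u v t = vertex_point ((1 - t) *: u + t *: v).
Proof.
move=> /edge_neq uv; rewrite !inE => /orP[] /eqP e.
  have t0 : t = 0 by apply: (seg_inj uv); rewrite e subr0 scale1r scale0r addr0.
  by rewrite e t0 edge_point0.
have t1 : t = 1 by apply: (seg_inj uv); rewrite e subrr scale1r scale0r add0r.
by rewrite e t1 edge_point1.
Qed.

Lemma place_inj P : embedded P -> {in realization P &, injective (place P)}.
Proof.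
move=> [em1 em2].
have ve u v t q : [fset u; v]%fset \in edges P -> q \in vertices P ->
    0 <= t <= 1 -> q = (1 - t) *: u + t *: v -> vertex_point q = edge_point u v t.
  move=> uvE qV t01 e; rewrite (edge_point_end uvE) -?e//.
  by apply: (em2 _ _ _ uvE qV); exists t.
move=> w w' /set_mem[[q qV <-]|[u [v [t [uvE t01 ->]]]]]
  /set_mem[[q' qV' <-]|[u' [v' [t' [uvE' t01' ->]]]]].
- by rewrite !place_vertex// => ->.
- by rewrite place_vertex// place_edge// => e; exact: ve.
- by rewrite place_vertex// place_edge// => e; apply/esym; exact: ve.
rewrite !place_edge// => e.
have [E|/eqP ne] := eqVneq [fset u; v]%fset [fset u'; v']%fset; last first.
  have [] := em1 _ _ _ _ uvE uvE' ne ((1 - t) *: u + t *: v).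
  - by exists t.
  - by exists t'.
  by move=> /(edge_point_end uvE) ->; rewrite e => /(edge_point_end uvE') ->.
have uv := edge_neq uvE; have uv' := edge_neq uvE'.
have : u \in [fset u'; v']%fset by rewrite -E !inE eqxx.
have : v \in [fset u'; v']%fset by rewrite -E !inE eqxx orbT.
rewrite !inE => /orP[] /eqP ve' /orP[] /eqP ue'; subst u v.
- by rewrite eqxx in uv.
- rewrite edge_pointC; congr (edge_point _ _ _); apply: (seg_inj uv').
  by rewrite -e subKr addrC.
- by rewrite (seg_inj uv' e).
- by rewrite eqxx in uv.
Qed.

Lemma realization_embedded P : embedded P ->
  homeomorphism (realization P) (carrier P) (place P) /\
  {in vertices P, forall q, place P (vertex_point q) = q}.
Proof.
move=> eP; split; last by move=> q qV; exact: place_vertex.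
apply: (compact_homeomorphism (vertex_point 0)).
- exact: norm_hausdorff.
- exact: realization_compact.
- by apply: continuous_subspaceT; exact: place_continuous.
split.
- move=> w [[q qV <-]|[u [v [t [uvE t01 ->]]]]].
    by rewrite place_vertex//; left.
  by rewrite place_edge//; right; exists u, v; split => //; exists t.
- exact: place_inj.
- move=> x [/= qV|[u [v [uvE [t t01 ->]]]]].
    by exists (vertex_point x); [left; exists x|exact: place_vertex].
  exists (edge_point u v t); last exact: place_edge.
  by right; exists u, v, t.
Qed.

Lemma parameterization_exists P : exists M, parameterization P M.
Proof.
pose bf (a : {fset R3 R}) : seq (arc R) :=
  if enum_fset a is [:: u; v] then [:: (u, v, false); (v, u, true)] else [::].
exists (map bf (edges P)); split.
  move=> c /mapP[a _ ->]; rewrite /bf.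
  by case: (enum_fset a) => [|u [|v [|]]]//=; rewrite /target/source/= !eqxx.
rewrite map_flatten -map_comp.
match goal with |- is_true (perm_eq ?s ?t) => suff -> : s = t by [] end.
congr flatten; apply/eq_in_map => a /edge_endpoints[a2 _].
have ha x : (x \in a) = (x \in enum_fset a) by [].
move: a2 ha; rewrite /bf /=; case: (enum_fset a) => [|u [|v [|]]]//= _ ha.
have -> : a = [fset u; v]%fset by apply/fsetP => x; rewrite ha !inE.
by rewrite /double_edge/= (fsetUC [fset v]%fset).
Qed.

End Realization.

(* Main.v *)
Require Import Defs.
From HB Require Import structures.
From mathcomp Require Import all_boot all_order all_algebra finmap.
From mathcomp Require Import all_classical all_reals all_analysis.
From mathcomp Require Import measurable_realfun ring lra.

Set Implicit Arguments.
Unset Strict Implicit.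
Unset Printing Implicit Defensive.

Import Order.TTheory GRing.Theory Num.Theory numFieldNormedType.Exports.
Local Open Scope classical_set_scope.
Local Open Scope ring_scope.

(** At a generic direction e, meaning that no two vertices have the same height
    <e, .>, every point of a parameterization of the double over a vertex q
    contributes half the sum of the signs of the two descents from q to its
    neighbors along the parameterization. Hence nlm(e, q) is half of
    net_descent e q, the number of edges going down from q minus the number of
    edges going up ([nlm_parameterization]), and the multiplicity is half of the
    sum of the positive parts of these numbers. The same sum is the integrand of
    4 NTC ([NTC_integral]). Since a plane through 0 meets the sphere in a null
    set, almost every direction is generic ([ae_separates]), and both claims
    follow from one inequality between integers at a generic e
    ([sum_net_descent_subdivision]).

    The homeomorphism h fixes the vertices of P, so it carries an edge {u, v} of P
    to a path of edges of P' from u to v whose inner vertices are not vertices of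
    P and have degree 2. Let u be the upper end of {u, v}. Replacing {u, v} by
    the first edge of its path can only increase the net descent at v. At u it
    can decrease it, by 2, and only when the path starts by going up; but then
    the highest vertex of the path is an inner vertex, a strict local maximum
    with net descent 2, and it pays for the loss. Different edges are paid for by
    different inner vertices.

    Only a few facts about paths are needed, collected in [subdivides], and they
    are obtained without compactness or connectedness of subspaces, from the
    intermediate value theorem for real functions of the parameter of an edge.
    The function edge_sign u v on the realization of P is positive on the
    open edge {u, v}, zero at u and v and negative elsewhere. Composed with the
    inverse of h along an open edge of P', it has no zero, so this open edge lies
    in the image of a single edge of P ([edge_inside]). That the edges of P and of
    P' at a common vertex correspond one to one ([first_vertices]) is
    the local invariance of the degree of a vertex: two edges of P' at u inside
    the image of {u, v} would both cover all points near u of this image. *)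

(** * The realization in barycentric coordinates *)

Section Coordinates.
Variable R : realType.
Implicit Types (P : polygonal_graph R) (u v x y q : R3 R) (t : R).
Implicit Types (w : {ptws R3 R -> R}).

Lemma neighborsP P u v :
  (v \in neighbors P u) = ([fset u; v]%fset \in edges P).
Proof.
rewrite !inE /=; have [uvP|] := boolP ([fset u; v]%fset \in edges P).
  by rewrite andbT (edge_vertices uvP).2.
by rewrite andbF.
Qed.

Lemma edge_point_source u v t : u != v -> edge_point u v t u = 1 - t.
Proof.
by move=> uv; rewrite /edge_point /vertex_point eqxx (negPf uv) mulr1 mulr0 addr0.
Qed.

Lemma edge_point_target u v t : u != v -> edge_point u v t v = t.
Proof.
by move=> uv; rewrite /edge_point /vertex_point eqxx eq_sym (negPf uv) mulr1 mulr0 add0r.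
Qed.

Lemma edge_point_outside u v t x : x != u -> x != v -> edge_point u v t x = 0.
Proof.
by move=> /negPf xu /negPf xv; rewrite /edge_point /vertex_point xu xv !mulr0 addr0.
Qed.

(** For u != v, a point with coordinates 1 - t and t at u and v is sent to
    t (1 - t). At a point off the edge {u, v} the product of the coordinates
    vanishes and their sum is less than 1, so the value
    w u * w v + (w u + w v - 1) is negative. *)
Definition edge_sign u v w : R := (1 + w u) * (1 + w v) - 2.

Lemma edge_signC u v w : edge_sign u v w = edge_sign v u w.
Proof. by rewrite /edge_sign mulrC. Qed.

Lemma edge_sign_edge_point u v t : u != v ->
  edge_sign u v (edge_point u v t) = t * (1 - t).
Proof.
by move=> uv; rewrite /edge_sign edge_point_source// edge_point_target//; ring.
Qed.

Lemma edge_sign_vertex_point u v q : u != v ->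
  0 <= edge_sign u v (vertex_point q) -> q = u \/ q = v.
Proof.
move=> uv; rewrite /edge_sign /vertex_point.
have [<-|uq] := eqVneq u q; first by left.
by have [<-|vq] := eqVneq v q; [right|rewrite !addr0 mulr1 => h; exfalso; lra].
Qed.

Lemma edge_sign_ge0 P u v w : [fset u; v]%fset \in edges P -> realization P w ->
  0 <= edge_sign u v w -> exists2 t, 0 <= t <= 1 & w = edge_point u v t.
Proof.
move=> uvP; have uv := edge_neq uvP.
have vertex_case q : 0 <= edge_sign u v (vertex_point q) ->
    exists2 t, 0 <= t <= 1 & vertex_point q = edge_point u v t.
  move=> /(edge_sign_vertex_point uv)[] ->.
    by exists 0; rewrite ?edge_point0// lexx ler01.
  by exists 1; rewrite ?edge_point1// ler01 lexx.
move=> [[q _ <-]|[x [y [t [xyP t01 ->]]]]]; first exact: vertex_case.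
have xy := edge_neq xyP.
have end_case : t = 0 \/ t = 1 -> 0 <= edge_sign u v (edge_point x y t) ->
    exists2 s, 0 <= s <= 1 & edge_point x y t = edge_point u v s.
  by case=> ->; rewrite ?edge_point0 ?edge_point1; exact: vertex_case.
have [ux|ux] := eqVneq u x; have [vy|vy] := eqVneq v y.
- by subst; exists t.
- have vx : v != x by rewrite -ux eq_sym.
  move=> s0; apply: end_case => //; left; move: s0.
  by rewrite /edge_sign ux edge_point_source// (edge_point_outside _ vx vy); lra.
- have uy : u != y by rewrite -vy.
  move=> s0; apply: end_case => //; right; move: s0.
  by rewrite /edge_sign vy edge_point_target// (edge_point_outside _ ux uy); lra.
have [uy|uy] := eqVneq u y; have [vx|vx] := eqVneq v x.
- by move=> _; exists (1 - t); [lra|subst; rewrite edge_pointC].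
- move=> s0; apply: end_case => //; right; move: s0.
  by rewrite /edge_sign uy edge_point_target// (edge_point_outside _ vx vy); lra.
- move=> s0; apply: end_case => //; left; move: s0.
  by rewrite /edge_sign vx edge_point_source// (edge_point_outside _ ux uy); lra.
by rewrite /edge_sign !edge_point_outside//; lra.
Qed.

Lemma edge_sign_gt0 P u v w : [fset u; v]%fset \in edges P -> realization P w ->
  0 < edge_sign u v w -> exists2 t, 0 < t < 1 & w = edge_point u v t.
Proof.
move=> uvP wP s0; have [t t01 wE] := edge_sign_ge0 uvP wP (ltW s0).
exists t => //; move: s0; rewrite wE edge_sign_edge_point ?(edge_neq uvP)//.
by nra.
Qed.

Lemma edge_sign_eq0 P u v w : [fset u; v]%fset \in edges P -> realization P w ->
  edge_sign u v w = 0 -> w = vertex_point u \/ w = vertex_point v.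
Proof.
move=> uvP wP s0.
have [|t t01 wE] := edge_sign_ge0 uvP wP; first by rewrite s0.
move/eqP: s0; rewrite wE edge_sign_edge_point ?(edge_neq uvP)// mulf_eq0.
rewrite subr_eq0 => /orP[/eqP->|/eqP<-]; first by left; rewrite edge_point0.
by right; rewrite edge_point1.
Qed.

(** The support of a point of an open edge is the pair of endpoints. *)
Lemma open_edge_unique P u v u' v' w : [fset u; v]%fset \in edges P ->
  [fset u'; v']%fset \in edges P -> realization P w ->
  0 < edge_sign u v w -> 0 < edge_sign u' v' w ->
  (u' = u /\ v' = v) \/ (u' = v /\ v' = u).
Proof.
move=> uvP uvP' wP /(edge_sign_gt0 uvP wP)[t t01 wE].
move=> /(edge_sign_gt0 uvP' wP)[t' t01' wE'].
have uv' := edge_neq uvP'.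
have supp x : 0 < w x -> x = u \/ x = v.
  have [->|xu] := eqVneq x u; first by left.
  have [->|xv] := eqVneq x v; first by right.
  by rewrite wE edge_point_outside// ltxx.
have /supp u'uv : 0 < w u' by rewrite wE' edge_point_source//; lra.
have /supp v'uv : 0 < w v' by rewrite wE' edge_point_target//; lra.
case: u'uv v'uv uv' => -> [] ->; rewrite ?eqxx//; by [left|right].
Qed.

Lemma realization_cases P w : realization P w ->
  (exists2 q, q \in vertices P & w = vertex_point q) \/
  exists u v, [fset u; v]%fset \in edges P /\ 0 < edge_sign u v w.
Proof.
move=> [[q qP <-]|[u [v [t [uvP t01 ->]]]]]; first by left; exists q.
have [uP vP] := edge_vertices uvP.
have [->|t0] := eqVneq t 0; first by left; exists u => //; rewrite edge_point0.
have [->|t1] := eqVneq t 1; first by left; exists v => //; rewrite edge_point1.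
right; exists u, v; split => //; rewrite edge_sign_edge_point ?(edge_neq uvP)//.
have : 0 < t by rewrite lt_def t0; case/andP: t01.
have : t < 1 by rewrite lt_def eq_sym t1; case/andP: t01.
by nra.
Qed.

Lemma realization_edge_point P u v t : [fset u; v]%fset \in edges P ->
  0 <= t <= 1 -> realization P (edge_point u v t).
Proof. by move=> uvP t01; right; exists u, v, t. Qed.

Lemma edge_point_is_vertex u v q t : u != v ->
  edge_point u v t = vertex_point q -> t = 0 \/ t = 1.
Proof.
move=> uv e; have [qv|qv] := eqVneq q v.
  right; rewrite -[t](edge_point_target t uv) e /vertex_point qv.
  by rewrite eqxx.
left; rewrite -[t](edge_point_target t uv) e /vertex_point eq_sym.
by rewrite (negPf qv).
Qed.

Lemma vertex_point_inj : injective (@vertex_point R).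
Proof.
move=> x y e; have := congr1 (fun w : {ptws R3 R -> R} => w x) e.
rewrite /vertex_point eqxx; case: eqVneq => // _ /eqP.
by rewrite oner_eq0.
Qed.

Lemma curve_coordinate_continuous (B : set {ptws R3 R -> R})
    (k : {ptws R3 R -> R} -> {ptws R3 R -> R}) u v x :
  {within B, continuous k} ->
  (forall t, 0 <= t <= 1 -> B (edge_point u v t)) ->
  {within `[0, 1]%classic, continuous (fun t => k (edge_point u v t) x)}.
Proof.
move=> kc pB; apply/subspace_continuousP => t /= t01.
have : (k z : {ptws R3 R -> R}) @[z --> within B (nbhs (edge_point u v t))]
    --> k (edge_point u v t).
  by move/subspace_continuousP : kc; apply; apply: pB; move: t01; rewrite in_itv.
move=> kcvg.
have pcvg : edge_point u v s @[s --> within `[0, 1]%classic (nbhs t)] -->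
    within B (nbhs (edge_point u v t)).
  move=> A /= nA; have := @edge_point_continuous R u v t _ nA.
  apply: (@filterS R (nbhs t)) => s /= + s01; apply; apply: pB.
  by move: s01; rewrite in_itv.
have kpcvg := @cvg_comp R {ptws R3 R -> R} {ptws R3 R -> R}
  (edge_point u v) k _ _ _ pcvg kcvg.
exact: (@cvg_comp R {ptws R3 R -> R} R _ (fun w => w x) _ _ _ kpcvg
  (@proj_continuous (R3 R) (fun=> R) x _)).
Qed.

Lemma pos_without_interior_zero (f : R -> R) t0 :
  {within `[0, 1]%classic, continuous f} ->
  (forall t, 0 < t < 1 -> f t != 0) -> 0 <= t0 <= 1 -> 0 < f t0 ->
  forall t, 0 <= t <= 1 -> 0 <= f t.
Proof.
move=> fc f0 t001 ft0 t t01; rewrite leNgt; apply/negP => ft.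
wlog : f fc t t0 t01 t001 f0 ft0 ft / t0 <= t => [th|t0t].
  have [|/ltW tt0] := leP t0 t; first exact: (th f).
  apply: (th (fun s => - f s) _ t0 t) => //=; rewrite ?oppr_gt0 ?oppr_lt0//.
    by move=> s; apply: continuousN; exact: fc.
  by move=> s s01; rewrite oppr_eq0; exact: f0.
have fc' : {within `[t0, t]%classic, continuous f}.
  apply: continuous_subspaceW fc => s /=; rewrite !in_itv /=; lra.
have [|c] := IVT (v := 0) t0t fc'.
  by rewrite ge_min le_max !(ltW ft0, ltW ft) orbT.
rewrite in_itv /= => /andP[t0c ct] fc0.
have t0c' : t0 != c by apply: contraTneq ft0 => ->; rewrite fc0 ltxx.
have ct' : c != t by apply: contraTneq ft => <-; rewrite fc0 ltxx.
have {t0c t0c'}t0c : t0 < c by rewrite lt_neqAle t0c' t0c.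
have {ct ct'}ct : c < t by rewrite lt_neqAle ct' ct.
have /andP[t00 _] := t001; have /andP[_ t1] := t01.
have := f0 c; rewrite fc0 eqxx (le_lt_trans t00 t0c) (lt_le_trans ct t1).
by move=> /(_ isT).
Qed.

End Coordinates.

(** * The image of an edge under the homeomorphism *)

Section Subdivision.
Variables (R : realType) (P P' : polygonal_graph R).
Variables h g : {ptws R3 R -> R} -> {ptws R3 R -> R}.
Hypothesis h_realization : forall w, realization P w -> realization P' (h w).
Hypothesis g_realization : forall z, realization P' z -> realization P (g z).
Hypothesis hK : forall w, realization P w -> g (h w) = w.
Hypothesis gK : forall z, realization P' z -> h (g z) = z.
Hypothesis h_continuous : {within realization P, continuous h}.
Hypothesis g_continuous : {within realization P', continuous g}.
Hypothesis h_vertex :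
  forall q, q \in vertices P -> h (vertex_point q) = vertex_point q.
Implicit Types (u v x y q n : R3 R) (t s : R).

Lemma g_vertex q : q \in vertices P -> g (vertex_point q) = vertex_point q.
Proof. by move=> qP; rewrite -{1}h_vertex// hK//; left; exists q. Qed.

Lemma open_edge_avoids_vertices x y t q : [fset x; y]%fset \in edges P' ->
  0 < t < 1 -> q \in vertices P -> g (edge_point x y t) <> vertex_point q.
Proof.
move=> xyP' t01 qP /(congr1 h); rewrite gK ?h_vertex//; last first.
  by apply: realization_edge_point => //; lra.
by move=> /(edge_point_is_vertex (edge_neq xyP')); lra.
Qed.

(** The function s |-> edge_sign u v (g (edge_point x y s)) has no zero on ]0, 1[:
    a zero would be sent by g to a vertex of P, and h fixes the vertices. So
    it keeps one sign, and by continuity its weak form extends to the ends. *)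
Lemma edge_inside u v x y t : [fset u; v]%fset \in edges P ->
  [fset x; y]%fset \in edges P' -> 0 <= t <= 1 ->
  0 < edge_sign u v (g (edge_point x y t)) ->
  (forall s, 0 <= s <= 1 -> 0 <= edge_sign u v (g (edge_point x y s))) /\
  (forall s, 0 < s < 1 -> 0 < edge_sign u v (g (edge_point x y s))).
Proof.
move=> uvP xyP' t01 ft.
have [uP vP] := edge_vertices uvP.
pose f s := edge_sign u v (g (edge_point x y s)).
have in_P s : 0 <= s <= 1 -> realization P' (edge_point x y s).
  exact: realization_edge_point.
have fc : {within `[0, 1]%classic, continuous f}.
  apply/subspace_continuousP => s s01.
  apply: cvgB; last exact: cvg_cst.
  have coordinate z : g (edge_point x y r) z @[r --> within `[0, 1]%classic (nbhs s)]
      --> g (edge_point x y s) z.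
    have /subspace_continuousP := curve_coordinate_continuous (x := z) g_continuous in_P.
    exact.
  by apply: cvgM; (apply: cvgD; first exact: cvg_cst); exact: coordinate.
have f0 s : 0 < s < 1 -> f s != 0.
  move=> s01; apply/eqP => /(edge_sign_eq0 uvP)[].
  - by apply: g_realization; apply: in_P; lra.
  - exact: open_edge_avoids_vertices.
  - exact: open_edge_avoids_vertices.
have f_ge0 := pos_without_interior_zero fc f0 t01 ft.
split=> // s s01; rewrite lt_def f0//=; apply: f_ge0; lra.
Qed.

(** As h is a bijection with inverse g, this says that q lies on the image under h
    of the closed edge {u, v}. *)
Definition on_edge u v q := 0 <= edge_sign u v (g (vertex_point q)).

(** By [edge_inside] the midpoint decides for the whole open edge {x, y} of P'
    whether it lies in the image of the open edge {u, v}. *)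
Definition runs_inside u v x y := 0 < edge_sign u v (g (edge_point x y 2^-1)).

Lemma on_edge_vertex u v q : u != v -> q \in vertices P -> on_edge u v q ->
  q = u \/ q = v.
Proof.
by move=> uv qP; rewrite /on_edge g_vertex//; exact: edge_sign_vertex_point.
Qed.

(** A point of the closed edge outside of the open one is a vertex of P, hence
    fixed by h. *)
Lemma on_edge_interior u v q : [fset u; v]%fset \in edges P ->
  q \in vertices P' -> q \notin vertices P -> on_edge u v q ->
  0 < edge_sign u v (g (vertex_point q)).
Proof.
move=> uvP qP' qP qe; have [uP vP] := edge_vertices uvP.
have q_real : realization P' (vertex_point q) by left; exists q.
have not_vertex x : x \in vertices P -> g (vertex_point q) <> vertex_point x.
  move=> xP /(congr1 h); rewrite gK// h_vertex// => /vertex_point_inj qx.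
  by rewrite qx xP in qP.
rewrite lt_def -/(on_edge u v q) qe andbT; apply/eqP => /(edge_sign_eq0 uvP)[].
- exact: g_realization.
- exact: not_vertex.
- exact: not_vertex.
Qed.

Lemma on_edge_neighbor u v q n : [fset u; v]%fset \in edges P ->
  q \notin vertices P -> [fset q; n]%fset \in edges P' ->
  on_edge u v q -> on_edge u v n.
Proof.
move=> uvP qP qnP' qe; have [qP' _] := edge_vertices qnP'.
have q_pos := on_edge_interior uvP qP' qP qe.
have [||inside _] := edge_inside (t := 0) uvP qnP'.
- by rewrite lexx ler01.
- by rewrite edge_point0.
by rewrite /on_edge -(edge_point1 q n); apply: inside; rewrite ler01 lexx.
Qed.

Lemma on_edge_unique u v u' v' q : [fset u; v]%fset \in edges P ->
  [fset u'; v']%fset \in edges P -> q \in vertices P' -> q \notin vertices P ->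
  on_edge u v q -> on_edge u' v' q ->
  (u' = u /\ v' = v) \/ (u' = v /\ v' = u).
Proof.
move=> uvP uvP' qP' qP qe qe'.
apply: (open_edge_unique uvP uvP' (w := g (vertex_point q))).
- by apply: g_realization; left; exists q.
- exact: on_edge_interior.
- exact: on_edge_interior.
Qed.

Lemma half01 : 0 < (2^-1 : R) < 1. Proof. lra. Qed.

Lemma half01W : 0 <= (2^-1 : R) <= 1. Proof. lra. Qed.

Lemma runs_inside_on_edge u v x y : [fset u; v]%fset \in edges P ->
  [fset x; y]%fset \in edges P' -> runs_inside u v x y -> on_edge u v y.
Proof.
move=> uvP xyP' /(edge_inside uvP xyP' half01W)[inside _].
by rewrite /on_edge -(edge_point1 x y); apply: inside; rewrite ler01 lexx.
Qed.

Lemma runs_inside_exists u n : u \in vertices P -> [fset u; n]%fset \in edges P' ->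
  exists2 v, [fset u; v]%fset \in edges P & runs_inside u v u n.
Proof.
move=> uP unP'.
have mid_real : realization P (g (edge_point u n 2^-1)).
  by apply: g_realization; exact: realization_edge_point half01W.
case: (realization_cases mid_real) => [[q qP /open_edge_avoids_vertices[]//]|].
  exact: half01.
move=> [x [y [xyP s0]]].
have [/(_ 0) + _] := edge_inside xyP unP' half01W s0.
rewrite edge_point0 g_vertex// lexx ler01 => /(_ isT).
move=> /(edge_sign_vertex_point (edge_neq xyP))[] ux; subst; first by exists y.
by exists x; [rewrite fsetUC|rewrite /runs_inside edge_signC].
Qed.

(** Leaving u along the edge {u, v}, the u-coordinate of the image under h goes
    continuously from 1 to 0. A point where it is 1/2 lies inside an edge of P'
    ending at u. *)
Lemma first_edge_exists u v : [fset u; v]%fset \in edges P ->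
  exists2 n, [fset u; n]%fset \in edges P' & runs_inside u v u n.
Proof.
move=> uvP; have [uP vP] := edge_vertices uvP; have uv := edge_neq uvP.
have in_P s : 0 <= s <= 1 -> realization P (edge_point u v s).
  exact: realization_edge_point.
have fc := curve_coordinate_continuous (x := u) h_continuous in_P.
have [|s] := IVT (v := 2^-1) ler01 fc.
  rewrite edge_point0 edge_point1 !h_vertex// /vertex_point eqxx (negPf uv).
  by rewrite ge_min le_max; case/andP: half01W => -> ->; rewrite orbT.
rewrite in_itv /= => s01 hs.
have s_neq : s != 0 /\ s != 1.
  split; apply/eqP => s_end; move: hs.
    rewrite s_end edge_point0 h_vertex// /vertex_point eqxx /=; lra.
  rewrite s_end edge_point1 h_vertex// /vertex_point (negPf uv) /=; lra.
have s_open : 0 < s < 1.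
  by case/andP: s01; case: s_neq; rewrite !lt_def eq_sym => -> + -> ->; rewrite eq_sym => ->.
have s_pos : 0 < edge_sign u v (edge_point u v s).
  by rewrite edge_sign_edge_point//; nra.
have [n [t [unP' t01 ht]]] : exists n t,
    [/\ [fset u; n]%fset \in edges P', 0 <= t <= 1 &
      h (edge_point u v s) = edge_point u n t].
  case: (h_realization (in_P s s01)) => [[q _ hq]|[x [y [t [xyP' t01 ht]]]]].
    move: hs; rewrite -hq /vertex_point; have [uq _|_ /=] := eqVneq u q; last lra.
    have /(congr1 g) := hq; rewrite hK//; last exact: in_P.
    rewrite -uq g_vertex// => us.
    by have := esym us => /(edge_point_is_vertex uv)[]; lra.
  have [ux|ux] := eqVneq u x; first by subst x; exists y, t.
  have [uy|uy] := eqVneq u y.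
    by subst y; exists x, (1 - t); rewrite fsetUC -edge_pointC; split=> //; lra.
  by move: hs; rewrite ht edge_point_outside//; lra.
exists n => //; apply: (edge_inside uvP unP' t01 _).2 half01.
by rewrite -ht hK//; exact: in_P.
Qed.

(** Two edges of P' at u running inside the image of {u, v} would, by the
    intermediate value theorem, share points close to u. *)
Lemma first_edge_unique u v n n' : [fset u; v]%fset \in edges P ->
  [fset u; n]%fset \in edges P' -> [fset u; n']%fset \in edges P' ->
  runs_inside u v u n -> runs_inside u v u n' -> n = n'.
Proof.
move=> uvP unP' unP'' rn rn'; have uv := edge_neq uvP.
have [uP vP] := edge_vertices uvP.
(* The v-coordinate is 0 at u and determines the point on the edge {u, v}, so
   the first half of {u, m} covers the points of coordinate at most its value c
   at the midpoint. *)
have param m : [fset u; m]%fset \in edges P' -> runs_inside u v u m ->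
    exists2 c, 0 < c & forall b, 0 < b <= c ->
      exists2 t, 0 < t < 1 & g (edge_point u m t) = edge_point u v b.
  move=> umP' rm; have [inside inside'] := edge_inside uvP umP' half01W rm.
  have in_P s : 0 <= s <= 1 -> realization P' (edge_point u m s).
    exact: realization_edge_point.
  have fc := curve_coordinate_continuous (x := v) g_continuous in_P.
  have f0 : g (edge_point u m 0) v = 0.
    by rewrite edge_point0 g_vertex// /vertex_point eq_sym (negPf uv).
  have fc' : {within `[0, 2^-1]%classic,
      continuous (fun t => g (edge_point u m t) v)}.
    apply: continuous_subspaceW fc => s /=; rewrite !in_itv /=; lra.
  exists (g (edge_point u m 2^-1) v).
    have [|s s01 ->] := edge_sign_gt0 uvP _ rm.
      by apply: g_realization; apply: in_P; exact: half01W.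
    by rewrite edge_point_target//; lra.
  move=> b /andP[b0 bc].
  have [|t] := IVT (v := b) (ltW (andP half01).1) fc'.
    by rewrite f0 ge_min le_max (ltW b0) bc orbT.
  rewrite in_itv /= => t01 tb.
  have t0 : t != 0 by apply: contraTneq b0 => t0; rewrite -tb t0 f0 ltxx.
  have t_open : 0 < t < 1.
    case/andP: t01 => t_ge0 t_le; apply/andP; split; last lra.
    by rewrite lt_neqAle t_ge0 andbT eq_sym.
  exists t => //.
  have t01' : 0 <= t <= 1 by lra.
  have [s s01 ge] := edge_sign_ge0 uvP (g_realization (in_P t t01')) (inside t t01').
  by rewrite ge; congr edge_point; rewrite -tb ge edge_point_target.
have [c c0 cP] := param n unP' rn; have [c' c0' cP'] := param n' unP'' rn'.
have b0 : 0 < Num.min c c' by rewrite lt_min c0.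
have [|t t01 gt] := cP (Num.min c c'); first by rewrite b0 ge_min lexx.
have [|t' t01' gt'] := cP' (Num.min c c'); first by rewrite b0 ge_min lexx orbT.
have /(congr1 h) : g (edge_point u n t) = g (edge_point u n' t') by rewrite gt gt'.
rewrite !gK; try by apply: realization_edge_point => //; lra.
move=> e; apply/eqP; apply: contraT => nn'.
have nu : n != u by rewrite eq_sym (edge_neq unP').
have := congr1 (fun w : {ptws R3 R -> R} => w n) e.
rewrite edge_point_target ?(edge_neq unP')// edge_point_outside// => t0.
by move: t01; rewrite t0 ltxx.
Qed.

(** Here [first u v] is the first vertex after u on the path of P' that is the image
    of the edge {u, v}. *)
Lemma first_vertices : exists first : R3 R -> R3 R -> R3 R,
  forall u, u \in vertices P ->
    perm_eq [seq first u v | v <- neighbors P u] (neighbors P' u) /\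
    forall v, v \in neighbors P u -> on_edge u v (first u v).
Proof.
have /choice[first firstP] : forall p : R3 R * R3 R, exists n,
    [fset p.1; p.2]%fset \in edges P ->
    [fset p.1; n]%fset \in edges P' /\ runs_inside p.1 p.2 p.1 n.
  move=> [u v] /=; have [/first_edge_exists[n nP' rn]|] := boolP (_ \in edges P).
    by exists n.
  by exists u.
exists (fun u v => first (u, v)) => u uP; split; last first.
  move=> v; rewrite neighborsP => uvP; have [fP' rf] := firstP (u, v) uvP.
  exact: runs_inside_on_edge uvP fP' rf.
apply: uniq_perm.
- rewrite map_inj_in_uniq ?fset_uniq// => v v'; rewrite !neighborsP => uvP uvP' e.
  have [fP' rf] := firstP (u, v) uvP; have [_ rf'] := firstP (u, v') uvP'.
  have mid_real : realization P (g (edge_point u (first (u, v)) 2^-1)).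
    by apply: g_realization; exact: realization_edge_point half01W.
  rewrite -e in rf'.
  by have [[_ ->]//|[uv _]] := open_edge_unique uvP uvP' mid_real rf rf';
    have := edge_neq uvP; rewrite uv eqxx.
- exact: fset_uniq.
move=> n; apply/mapP/idP => [[v + ->]|].
  by rewrite !neighborsP => /(firstP (u, v))[].
rewrite neighborsP => unP'; have [v uvP rn] := runs_inside_exists uP unP'.
exists v; first by rewrite neighborsP.
by have [fP' rf] := firstP (u, v) uvP; exact: first_edge_unique uvP unP' fP' rn rf.
Qed.

End Subdivision.

(** * Refining a graph does not decrease the total positive net descent *)

Section Combinatorics.
Variable R : realType.
Implicit Types (P Q : polygonal_graph R) (u v x y q n e : R3 R).

Lemma dotBr e x y : dot e (x - y) = dot e x - dot e y.
Proof. by rewrite /dot /=; ring. Qed.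

(** For e in general position this is twice nlm(e, q); for every e it is the sum
    of the chi_i(e) in the integrand of ntc(q). *)
Definition net_descent Q e q : R :=
  \sum_(v <- neighbors Q q) Num.sg (dot e (q - v)).

Definition separates (s : {fset R3 R}) e : Prop :=
  forall x y, x \in s -> y \in s -> x != y -> dot e (x - y) != 0.

(** All that the comparison needs to know about the paths of P' that replace the
    edges of P: [on_edge u v] contains the vertices of the path replacing {u, v},
    and [first u v] is its first vertex after u. *)
Record subdivides P P' (on_edge : R3 R -> R3 R -> pred (R3 R))
    (first : R3 R -> R3 R -> R3 R) : Prop := Subdivides {
  sub_vertices : (vertices P `<=` vertices P')%fset;
  sub_degree : forall q, q \in vertices P' -> q \notin vertices P ->
    degree P' q = 2%N;
  sub_first : forall u, u \in vertices P ->
    perm_eq [seq first u v | v <- neighbors P u] (neighbors P' u);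
  sub_first_on : forall u v, [fset u; v]%fset \in edges P ->
    on_edge u v (first u v);
  sub_on_vertex : forall u v q, [fset u; v]%fset \in edges P ->
    q \in vertices P -> on_edge u v q -> q = u \/ q = v;
  sub_on_neighbor : forall u v q n, [fset u; v]%fset \in edges P ->
    q \notin vertices P -> [fset q; n]%fset \in edges P' ->
    on_edge u v q -> on_edge u v n;
  sub_on_unique : forall u v u' v' q, [fset u; v]%fset \in edges P ->
    [fset u'; v']%fset \in edges P -> q \in vertices P' ->
    q \notin vertices P -> on_edge u v q -> on_edge u' v' q ->
    (u' = u /\ v' = v) \/ (u' = v /\ v' = u)
}.

Lemma separates_edge Q (s : {fset R3 R}) e x y : (vertices Q `<=` s)%fset ->
  separates s e -> [fset x; y]%fset \in edges Q -> dot e (x - y) != 0.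
Proof.
move=> /fsubsetP Qs sep xyQ; have [xQ yQ] := edge_vertices xyQ.
by apply: sep; rewrite ?(edge_neq xyQ)//; exact: Qs.
Qed.

Lemma edge_pair Q a : a \in edges Q -> exists x y, a = [fset x; y]%fset.
Proof.
move=> /edge_endpoints[a2 _].
have in_a x : (x \in a) = (x \in enum_fset a) by [].
move: a2 in_a => /=; case: (enum_fset a) => [|x [|y [|]]]//= _ in_a.
by exists x, y; apply/fsetP => z; rewrite in_a !inE.
Qed.

Lemma edge_through Q q a : a \in edges Q -> q \in a ->
  exists v, a = [fset q; v]%fset.
Proof.
move=> /edge_pair[x [y ->]]; rewrite !inE => /orP[] /eqP ->; first by exists y.
by exists x; rewrite fsetUC.
Qed.

Lemma size_neighbors Q q : size (neighbors Q q) = degree Q q.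
Proof.
rewrite -(size_map (fun v => [fset q; v]%fset)); apply/perm_size/uniq_perm.
- rewrite map_inj_in_uniq ?fset_uniq// => v v'; rewrite !neighborsP => vQ vQ' e.
  have : v' \in [fset q; v]%fset by rewrite e !inE eqxx orbT.
  have /negPf := edge_neq vQ'; rewrite eq_sym => v'q.
  by rewrite !inE v'q => /eqP.
- exact: fset_uniq.
move=> a; rewrite !inE /=; apply/mapP/andP => [[v]|[aQ qa]].
  by rewrite neighborsP => vQ ->; rewrite vQ !inE eqxx.
have [v aE] := edge_through aQ qa; exists v => //.
by rewrite neighborsP -aE.
Qed.

Lemma exists_highest (T : eqType) (f : T -> R) (s : seq T) (x : T) : x \in s ->
  exists2 y : T, y \in s & forall z, z \in s -> f z <= f y.
Proof.
elim: s x => // a s IHs x _; case: s IHs => [_|b s /(_ b (mem_head _ _))[y ys ymax]].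
  by exists a; rewrite ?mem_head// => z; rewrite inE => /eqP->.
have [fay|/ltW fya] := leP (f a) (f y).
  by exists y => [|z]; rewrite inE ?ys ?orbT// => /predU1P[->|/ymax].
exists a; first exact: mem_head.
by move=> z; rewrite inE => /predU1P[->//|/ymax/le_trans]; exact.
Qed.

Lemma ler_sum_subseq (T : eqType) (F : T -> R) (s t : seq T) :
  uniq s -> uniq t -> {subset s <= t} -> (forall x : T, 0 <= F x) ->
  \sum_(x <- s) F x <= \sum_(x <- t) F x.
Proof.
move=> us ut st F0; rewrite (perm_big [seq x <- t | x \in s]) /=; last first.
  apply: uniq_perm; rewrite ?filter_uniq// => x; rewrite mem_filter.
  by have [/st->|] := boolP (x \in s).
rewrite big_filter big_mkcond; apply: ler_sum => x _.
by case: ifP.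
Qed.

Section Excess.
Variables (P P' : polygonal_graph R) (on_edge : R3 R -> R3 R -> pred (R3 R)).
Variables (first : R3 R -> R3 R -> R3 R) (e : R3 R).
Hypothesis sub : subdivides P P' on_edge first.
Hypothesis sep : separates (vertices P') e.

Let V_sub q : q \in vertices P -> q \in vertices P'.
Proof. by move: q; apply/fsubsetP; exact: sub_vertices sub. Qed.

(** The edges {u, v} whose replacement decreases the net descent at their upper end u:
    v is below u, but the path from u to v starts by going up. *)
Let turning u v := (dot e v < dot e u) && (dot e u < dot e (first u v)).

Let first_edge u v : [fset u; v]%fset \in edges P ->
  [fset u; first u v]%fset \in edges P'.
Proof.
move=> uvP; have [uP vP] := edge_vertices uvP.
rewrite -neighborsP -(perm_mem (sub_first sub uP)); apply: map_f.
by rewrite neighborsP.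
Qed.

(** Each sign in the net descent lies in {-1, 1}; it drops, by 2, only for a turning
    edge. *)
Lemma net_descent_vertex u : u \in vertices P ->
  Num.max (net_descent P e u) 0 <= Num.max (net_descent P' e u) 0 +
    \sum_(v <- neighbors P u) (turning u v)%:R * 2.
Proof.
move=> uP; set S := \sum_(v <- _) _.
have S0 : 0 <= S by apply: sumr_ge0 => v _; rewrite mulr_ge0.
suff le : net_descent P e u <= net_descent P' e u + S.
  rewrite ge_max; apply/andP; split.
    by apply: le_trans le _; rewrite lerD2r le_max lexx.
  by rewrite addr_ge0// le_max lexx orbT.
rewrite /net_descent -(perm_big _ (sub_first sub uP)) /= big_map -big_split /=.
rewrite big_seq [leRHS]big_seq; apply: ler_sum => v; rewrite neighborsP => uvP.
have := separates_edge (sub_vertices sub) sep uvP.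
have := separates_edge (fsubset_refl _) sep (first_edge uvP).
rewrite /turning -(subr_gt0 (dot e v)) -(subr_gt0 (dot e u)) -!dotBr.
have -> : dot e (first u v - u) = - dot e (u - first u v) by rewrite !dotBr opprB.
rewrite oppr_gt0.
case: (sgrP (dot e (u - first u v))) => // _ _; case: sgrP => //= _ _; lra.
Qed.

(** The highest vertex of the path is above u, hence above v, so it is an inner
    vertex; both of its neighbors lie on the path, hence below it. *)
Lemma turning_edge_has_peak u v : [fset u; v]%fset \in edges P -> turning u v ->
  exists x, [/\ x \in vertices P', x \notin vertices P, on_edge u v x &
    net_descent P' e x = 2].
Proof.
move=> uvP /andP[vu uf].
have [_ fP'] := edge_vertices (first_edge uvP).
have f_in : first u v \in [seq x <- vertices P' | on_edge u v x].
  by rewrite mem_filter fP' (sub_first_on sub uvP).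
have [x] := exists_highest (dot e) f_in.
rewrite mem_filter => /andP[xe xP'] xmax.
have ux : dot e u < dot e x by exact: lt_le_trans uf (xmax _ f_in).
have xP : x \notin vertices P.
  apply/negP => xP; have [xu|xv] := sub_on_vertex sub uvP xP xe.
    by rewrite xu ltxx in ux.
  by have := lt_trans vu ux; rewrite xv ltxx.
exists x; split=> //; rewrite /net_descent big_seq (eq_bigr (fun=> 1)).
  rewrite -big_seq big_const_seq count_predT size_neighbors (sub_degree sub xP' xP).
  by rewrite /= addr0.
move=> n; rewrite neighborsP => xnP'; have [_ nP'] := edge_vertices xnP'.
have := separates_edge (fsubset_refl _) sep xnP'.
have : 0 <= dot e (x - n).
  rewrite dotBr subr_ge0; apply: xmax; rewrite mem_filter nP' andbT.
  exact: (sub_on_neighbor sub uvP xP xnP' xe).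
by case: sgrP.
Qed.

(** Turning edges have different peaks, since an inner vertex lies on one path
    only, and the upper end orients the edge. *)
Lemma sum_net_descent_subdivision :
  \sum_(q <- vertices P) Num.max (net_descent P e q) 0 <=
  \sum_(q <- vertices P') Num.max (net_descent P' e q) 0.
Proof.
pose F x := Num.max (net_descent P' e x) 0.
have F0 x : 0 <= F x by rewrite le_max lexx orbT.
pose L := [seq p <- [seq (u, v) | u <- vertices P, v <- neighbors P u] |
  turning p.1 p.2].
have L_uniq : uniq L.
  apply: filter_uniq; apply: allpairs_uniq_dep; first exact: fset_uniq.
    by move=> u _; exact: fset_uniq.
  by move=> [u v] [u' v'] _ _ /= [-> ->].
have L_mem u v : (u, v) \in L -> [fset u; v]%fset \in edges P /\ turning u v.
  rewrite mem_filter /= => /andP[tuv /allpairsPdep[u' [v' [_ vN [uE vE]]]]].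
  by rewrite uE vE -neighborsP vN -uE -vE.
have /choice[peak peakP] : forall p : R3 R * R3 R, exists x, p \in L ->
    [/\ x \in vertices P', x \notin vertices P, on_edge p.1 p.2 x &
      net_descent P' e x = 2].
  move=> [u v]; have [/L_mem[uvP tuv]|] := boolP ((u, v) \in L); last by exists 0.
  by have [x xP] := turning_edge_has_peak uvP tuv; exists x.
have peak_inj : {in L &, injective peak}.
  move=> [u v] [u' v'] pL pL' px.
  have [xP' xP xe _] := peakP _ pL; have [_ _ xe' _] := peakP _ pL'.
  have [uvP /andP[vu _]] := L_mem _ _ pL; have [uvP' /andP[vu' _]] := L_mem _ _ pL'.
  rewrite -px in xe'.
  have [[-> ->]//|[uv vu'']] := sub_on_unique sub uvP uvP' xP' xP xe xe'.
  by move: vu'; rewrite uv vu'' => /(lt_trans vu); rewrite ltxx.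
apply: (@le_trans _ _ (\sum_(q <- vertices P ++ map peak L) F q)); last first.
  apply: ler_sum_subseq => //.
    rewrite cat_uniq fset_uniq map_inj_in_uniq// L_uniq andbT /=.
    by apply/hasPn => x /mapP[p /peakP[_ + _ _] ->].
  move=> x; rewrite mem_cat => /orP[/V_sub//|/mapP[p /peakP[+ _ _ _] ->]].
  exact.
rewrite big_cat big_map /=.
have -> : \sum_(p <- L) F (peak p) =
    \sum_(u <- vertices P) \sum_(v <- neighbors P u) (turning u v)%:R * 2.
  rewrite big_seq (eq_bigr (fun=> 2)) => [|p /peakP[_ _ _ peak2]]; last first.
    by rewrite /F peak2 max_l.
  rewrite -big_seq big_filter big_mkcond big_allpairs_dep /=.
  apply: eq_bigr => u _; apply: eq_bigr => v _ /=.
  by case: (turning u v); rewrite ?mul1r ?mul0r.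
rewrite -big_split /= big_seq [leRHS]big_seq; apply: ler_sum => u uP.
exact: net_descent_vertex.
Qed.

End Excess.
End Combinatorics.

(** * Counting local extrema along a parameterization *)

Section Parameterization.
Variable R : realType.
Implicit Types (P : polygonal_graph R) (u v x y q n e : R3 R).

Lemma dotZr e x (a : R) : dot e (a *: x) = a * dot e x.
Proof.
transitivity (e.1.1 * (a * x.1.1) + e.1.2 * (a * x.1.2) + e.2 * (a * x.2)).
  by [].
by rewrite /dot; ring.
Qed.

Lemma dotDr e x y : dot e (x + y) = dot e x + dot e y.
Proof. by rewrite /dot /=; ring. Qed.

Lemma dotNl e x : dot (- e) x = - dot e x.
Proof. by rewrite /dot /=; ring. Qed.

Lemma dot_passage e u q v (t : R) : dot e (passage u q v t) =
  dot e q + (if t <= 0 then t * dot e (q - u) else - t * dot e (q - v)).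
Proof.
rewrite /passage; case: ifP => _.
  by rewrite (dotBr e q (_ *: _)) dotZr !dotBr; ring.
by rewrite (dotDr e q (_ *: _)) dotZr !dotBr; ring.
Qed.

(** Both branches of the passage are affine, so the sign of each slope decides. *)
Lemma local_max_passage e u q v : dot e (q - u) != 0 -> dot e (q - v) != 0 ->
  `[< local_max (fun t => dot e (passage u q v t)) >] =
  (0 < dot e (q - u)) && (0 < dot e (q - v)).
Proof.
move=> uq vq; apply/asboolP/andP => [|[qu qv]]; last first.
  apply: (@filterE R (nbhs (0 : R))) => t; rewrite !dot_passage lexx mul0r addr0 gerDl.
  case: ifPn => [t0|]; first by rewrite mulr_le0_ge0// ltW.
  by rewrite -ltNge => t0; rewrite mulNr oppr_le0 mulr_ge0// ltW.
rewrite /local_max -nbhs_nearE => /nbhs_ballP[d /= d0 dP].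
have half_d s : `|s| = 1 -> `|0 - s * (d / 2)| < d.
  move=> s1; rewrite sub0r normrN normrM s1 mul1r gtr0_norm ?divr_gt0//.
  by rewrite ltr_pdivrMr// ltr_pMr// ltr1n.
split.
  have := dP _ (half_d (-1) (normrN1 _)).
  rewrite /= !dot_passage lexx mul0r addr0 gerDl mulN1r oppr_le0.
  rewrite (ltW (divr_gt0 d0 (ltr0Sn _ _))) mulNr oppr_le0 pmulr_rge0 ?divr_gt0//.
  by rewrite lt_def uq.
have := dP _ (half_d 1 (normr1 _)).
rewrite /= !dot_passage lexx mul0r addr0 gerDl mul1r (leNgt (d / 2)) divr_gt0//=.
by rewrite mulNr oppr_le0 pmulr_rge0 ?divr_gt0// lt_def vq.
Qed.

Lemma local_min_passage e u q v : dot e (q - u) != 0 -> dot e (q - v) != 0 ->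
  `[< local_min (fun t => dot e (passage u q v t)) >] =
  (dot e (q - u) < 0) && (dot e (q - v) < 0).
Proof.
move=> uq vq; have := @local_max_passage (- e) u q v.
rewrite !dotNl !oppr_eq0 !oppr_gt0 => /(_ uq vq) <-.
by congr asbool; apply/propext; split; apply: filterS => t; rewrite !dotNl lerN2.
Qed.

Lemma max_sub_min_passage e u q v : dot e (q - u) != 0 -> dot e (q - v) != 0 ->
  `[< local_max (fun t => dot e (passage u q v t)) >]%:R -
  `[< local_min (fun t => dot e (passage u q v t)) >]%:R =
  (Num.sg (dot e (q - u)) + Num.sg (dot e (q - v))) / 2.
Proof.
move=> uq vq; rewrite local_max_passage// local_min_passage//.
move: uq vq; case: sgrP => // _ _; case: sgrP => //= _ _; lra.
Qed.

Lemma sum_next (T : eqType) (c : seq T) (F : T -> R) : uniq c ->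
  \sum_(d <- c) F (next c d) = \sum_(d <- c) F d.
Proof.
move=> uc; rewrite -(big_map (next c) predT F); apply: perm_big.
apply: uniq_perm => //; first by rewrite (map_inj_uniq (can_inj (prev_next uc))).
move=> d; apply/mapP/idP => [[x xc ->]|dc]; first by rewrite mem_next.
by exists (prev c d); rewrite ?mem_prev ?next_prev.
Qed.

Lemma fset2_eq q x v : q != x -> q != v ->
  ([fset q; x]%fset == [fset q; v]%fset) = (v == x).
Proof.
move=> qx qv; apply/eqP/eqP => [e|->//].
have : v \in [fset q; x]%fset by rewrite e !inE eqxx orbT.
by rewrite !inE eq_sym (negPf qv) => /eqP.
Qed.

Lemma sum_only (T : eqType) (s : seq T) (F : T -> R) (A : pred T) (a : T) :
  uniq s -> a \in s -> A a -> {in s, forall b, A b -> b = a} ->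
  \sum_(b <- s | A b) F b = F a.
Proof.
move=> us sa Aa A1; rewrite big_mkcond (bigD1_seq a)//= Aa big1_seq ?addr0//.
by move=> b /andP[ba /A1 bA]; case: ifPn => // /bA ba'; rewrite ba' eqxx in ba.
Qed.

(** An arc contributes to q through each of its ends that is q. Written as a sum over
    the neighbors of q, this contribution depends only on the unoriented edge. *)
Lemma sum_edge_at P q (F : R3 R -> R) x y : [fset x; y]%fset \in edges P ->
  \sum_(v <- neighbors P q | [fset x; y]%fset == [fset q; v]%fset) F v =
  (if y == q then F x else 0) + (if x == q then F y else 0).
Proof.
have star z : [fset q; z]%fset \in edges P ->
    \sum_(v <- neighbors P q | [fset q; z]%fset == [fset q; v]%fset) F v = F z.
  move=> qzP; apply: sum_only; rewrite ?fset_uniq ?neighborsP//.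
  move=> v; rewrite neighborsP => qvP.
  by rewrite fset2_eq ?(edge_neq qzP) ?(edge_neq qvP)// => /eqP.
move=> xyP; have xy := edge_neq xyP.
have [yq|yq] := eqVneq y q.
  by rewrite -yq (negPf xy) addr0 fsetUC yq star// -yq fsetUC.
have [xq|xq] := eqVneq x q; first by rewrite -xq add0r xq star// -xq.
rewrite addr0 big1// => v /eqP e.
have : q \in [fset x; y]%fset by rewrite e !inE eqxx.
by rewrite !inE eq_sym (negPf xq) eq_sym (negPf yq).
Qed.

(** The points over q are the arcs ending at q, each followed by an arc starting at
    q. Reindexing the outgoing terms along the cycles turns the count of extrema
    into a sum over arcs of a contribution of the underlying edge; the two arcs
    over each edge compensate the factor 1/2 of [max_sub_min_passage]. *)
Lemma nlm_parameterization P M e q : parameterization P M ->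
  (forall x y, [fset x; y]%fset \in edges P -> dot e (x - y) != 0) ->
  nlm M e q = net_descent P e q / 2.
Proof.
move=> [M_cycle M_edges] sep; pose s x := Num.sg (dot e (q - x)).
have M_uniq : uniq (flatten M).
  apply: map_uniq (@double_edge R) _ _; rewrite (perm_uniq M_edges).
  by rewrite allpairs_uniq ?fset_uniq// => -[? ?] [? ?] _ _ /= [-> ->].
have c_uniq c : c \in M -> uniq c.
  elim: (M) M_uniq => //= a M0 IHM; rewrite cat_uniq => /and3P[ua _ /IHM uM].
  by rewrite inE => /predU1P[->|].
have arc_edge c d : c \in M -> d \in c -> [fset source d; target d]%fset \in edges P.
  move=> cM dc; have : double_edge d \in map (@double_edge R) (flatten M).
    by apply: map_f; apply/flattenP; exists c.
  by rewrite (perm_mem M_edges) => /allpairsP[[a b] [/= aP _ [-> _]]].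
pose into d := if target d == q then s (source d) else 0.
pose out d := if source d == q then s (target d) else 0.
have extrema : (lmax M e q)%:R - (lmin M e q)%:R =
    \sum_(c <- M) \sum_(d <- c) (into d + out d) / 2.
  rewrite /lmax /lmin !natr_sum -sumrB big_seq [RHS]big_seq.
  apply: eq_bigr => c cM.
  transitivity (\sum_(d <- c) (into d + out (next c d)) / 2); last first.
    by rewrite -!mulr_suml !big_split /= sum_next// c_uniq.
  rewrite -!sum1_count !natr_sum [X in X - _]big_mkcond [X in _ - X]big_mkcond /=.
  rewrite -sumrB big_seq [RHS]big_seq.
  apply: eq_bigr => d dc; have := next_cycle (M_cycle c cM) dc => /= /eqP qn.
  rewrite /into /out -qn; have [tq|_] /= := eqVneq (target d) q; last first.
    by rewrite subr0 addr0 mul0r.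
  rewrite /s -tq.
  have dP := arc_edge c d cM dc; have := arc_edge c (next c d) cM.
  rewrite mem_next -qn => /(_ dc) nP.
  rewrite -max_sub_min_passage; last 2 first.
  - by apply: sep; rewrite fsetUC.
  - exact: sep.
  rewrite /height; do 2 case: asboolP => _; by rewrite ?subr0.
rewrite /nlm extrema; congr (_ / 2).
transitivity ((\sum_(d <- flatten M)
    \sum_(v <- neighbors P q | (double_edge d).1 == [fset q; v]%fset) s v) / 2).
  rewrite big_flatten /= mulr_suml big_seq [RHS]big_seq; apply: eq_bigr => c cM.
  rewrite mulr_suml big_seq [RHS]big_seq; apply: eq_bigr => d dc.
  by rewrite sum_edge_at//; exact: arc_edge dc.
rewrite -(big_map (@double_edge R) predT (fun ab => \sum_(v <- neighbors P q |
  ab.1 == [fset q; v]%fset) s v)) (perm_big _ M_edges) big_allpairs /=.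
under eq_bigr do rewrite big_cons big_seq1 -mulr2n -mulr_natr.
rewrite -mulr_suml mulfK ?pnatr_eq0// /net_descent.
under eq_bigr do rewrite big_mkcond /=.
rewrite exchange_big /= big_seq [RHS]big_seq; apply: eq_bigr => v.
rewrite neighborsP => qvP; rewrite -big_mkcond /=.
apply: (@sum_only _ _ (fun=> s v) _ [fset q; v]%fset) => //; first exact: fset_uniq.
by move=> a _ /eqP.
Qed.

End Parameterization.

(** * Almost every direction is generic *)

Section Genericity.
Variable R : realType.
Implicit Types (P : polygonal_graph R) (u v x y q w e : R3 R).

Definition plane w : set (R3 R) := [set x | dot x w = 0].

Lemma measurable_dot_left w : measurable_fun [set: R3 R] (fun x => dot x w).
Proof. by apply: measurable_dot => //; exact: measurable_id. Qed.

Lemma measurable_plane w : measurable (plane w).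
Proof.
rewrite (_ : plane w = (fun x => dot x w) @^-1` [set 0]) //.
by rewrite -[X in measurable X]setTI; exact: measurable_dot_left.
Qed.

(** Fubini: the measure of A is the integral of the measures of its sections. *)
Lemma null_sections d (T : measurableType d) (m : {measure set T -> \bar R})
    (A : set (T * R)) : (forall x : T, exists z, xsection A x `<=` [set z]) ->
  measurable A -> (m \x @leb R)%E A = 0%E.
Proof.
move=> A1 mA; rewrite /= /product_measure1 /= integral0_eq// => x _.
have [z Az] := A1 x; apply/eqP; rewrite -measure_le0.
rewrite -(lebesgue_measure_set1 z); apply: (le_measure (@leb R)) => //; rewrite inE //=.
exact: measurable_xsection.
Qed.

(** If the last coefficient is not 0, the plane is a graph over the first two
    coordinates. Otherwise it is a cylinder over a line of the plane, and the line
    is treated in the same way. *)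
Lemma volume_plane w : w != 0 -> volume R (plane w) = 0%E.
Proof.
case: w => [[a b] c] w0.
have linear_root (k l : R) : k != 0 ->
    exists z, [set t | l + t * k = 0] `<=` [set z].
  by move=> k0; exists (- l / k) => t /= tk; apply: (mulIf k0); rewrite divfK//; lra.
have [c0|c0] := eqVneq c 0; last first.
  apply: null_sections; last exact: measurable_plane.
  move=> [x1 x2]; have [z Az] := linear_root c (x1 * a + x2 * b) c0.
  by exists z => t; rewrite /xsection /= inE => tA; apply: Az.
pose L : set (R * R) := [set p | p.1 * a + p.2 * b = 0].
have mL : measurable L.
  rewrite (_ : L = (fun p => p.1 * a + p.2 * b) @^-1` [set 0]) //.
  rewrite -[X in measurable X]setTI.
  by apply: measurable_funD => //; apply: measurable_funM.
have planeE : plane (a, b, c) = L `*` setT.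
  apply/seteqP; split=> -[[x1 x2] x3]; rewrite /plane /L /dot /= c0 mulr0 addr0//.
  by case.
suff L0 : (@leb R \x @leb R)%E L = 0%E.
  rewrite planeE; transitivity ((@leb R \x @leb R)%E L * @leb R setT)%E.
    exact: product_measure1E.
  by rewrite L0 mul0e.
have [b0|b0] := eqVneq b 0; last first.
  apply: null_sections => // x1; have [z Az] := linear_root b (x1 * a) b0.
  by exists z => t; rewrite /xsection /= inE => tA; apply: Az.
have a0 : a != 0 by apply: contraNneq w0 => ->; rewrite b0 c0.
have LE : L = [set 0] `*` setT.
  apply/seteqP; split=> -[x1 x2]; rewrite /L /= b0 mulr0 addr0.
    by move=> /eqP; rewrite mulf_eq0 (negPf a0) orbF => /eqP.
  by case=> -> _; rewrite mul0r.
rewrite LE; transitivity (@leb R [set 0%R] * @leb R setT)%E.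
  exact: product_measure1E.
by rewrite /leb lebesgue_measure_set1 mul0e.
Qed.

Lemma dotC x y : dot x y = dot y x.
Proof. by rewrite /dot; ring. Qed.

Lemma sphere_area_plane w : w != 0 -> @sphere_area R (plane w) = 0%E.
Proof.
move=> w0; rewrite /sphere_area (_ : volume R _ = 0%E) ?mule0//.
apply/eqP; rewrite -measure_le0 -(volume_plane w0).
have mcone : measurable (@normalize R @^-1` plane w `&` @punctured_ball R).
  apply: measurableI; last exact: measurable_punctured_ball.
  rewrite -[X in measurable X]setTI; apply: measurable_normalize => //.
  exact: measurable_plane.
apply: (le_measure (volume R)); rewrite ?inE //; first exact: measurable_plane.
move=> x [/=]; rewrite /plane /= /normalize /punctured_ball /= => xw /andP[x0 _].
have : (norm3 x)^-1 * dot x w = 0.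
  by rewrite -xw dotC (dotC _ w) dotZr.
by move/eqP; rewrite mulf_eq0 invr_eq0 (gt_eqF x0) => /eqP.
Qed.

Lemma ae_separates (s : {fset R3 R}) : {ae @sphere_area R, forall e, separates s e}.
Proof.
have pair_case p : {ae @sphere_area R, forall e, p.1 != p.2 -> dot e (p.1 - p.2) != 0}.
  exists (if p.1 != p.2 then plane (p.1 - p.2) else set0); split.
  - by case: ifP => // _; exact: measurable_plane.
  - by case: ifPn => // p12; rewrite ?measure0// sphere_area_plane// subr_eq0.
  - move=> e /= /not_implyP[p12 /negP]; rewrite negbK p12 => /eqP; exact.
have all_pairs (l : seq (R3 R * R3 R)) : {ae @sphere_area R,
    forall e, forall p, p \in l -> p.1 != p.2 -> dot e (p.1 - p.2) != 0}.
  elim: l => [|p l IHl]; first exact: aeW.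
  have := pair_case p; move: IHl; apply: filterS2 => e IHl pe p'.
  by rewrite inE => /predU1P[->|/IHl].
apply: filterS (all_pairs [seq (x, y) | x <- s, y <- s]) => e sep x y xs ys.
by apply: (sep (x, y)); apply/allpairsP; exists (x, y).
Qed.

(** * Net total curvature as an integral of net descents *)

Lemma measurable_S2 : measurable (@S2 R).
Proof.
rewrite (_ : @S2 R = @norm3 R @^-1` [set 1])//.
by rewrite -[X in measurable X]setTI; exact: measurable_norm3.
Qed.

Lemma measurable_net_descent P q (D : set (R3 R)) : measurable_fun D
  (fun e => Num.max (net_descent P e q) 0).
Proof.
apply: measurable_funTS; apply: measurable_maxr => //; apply: measurable_sum => v.
rewrite (_ : (fun e => _) = fun e => if 0 < dot e (q - v) then 1 else
    if dot e (q - v) < 0 then -1 else 0); last first.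
  by apply/funext => e; case: sgrP.
have mdot := measurable_dot_left (q - v).
apply: measurable_fun_ifT => //; first exact: measurable_fun_ltr.
by apply: measurable_fun_ifT => //; exact: measurable_fun_ltr.
Qed.

Lemma chi_normalize u v e : u != v -> chi (normalize (v - u)) e = Num.sg (dot e (u - v)).
Proof.
move=> uv; rewrite /chi /normalize dotZr sgrM.
have vu0 : 0 < norm3 (v - u).
  rewrite sqrtr_gt0; move: uv; rewrite eq_sym -subr_eq0.
  case: (v - u) => [[a b] c]; apply: contraNT; rewrite -leNgt /dot /= => h.
  have [-> -> ->] : [/\ a = 0, b = 0 & c = 0] by split; nra.
  by [].
by rewrite (gtr0_sg (x := _^-1)) ?invr_gt0// mul1r -sgrN !dotBr opprB.
Qed.

Lemma ntcE P q : ntc P q = ((4^-1)%:E *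
  \int[@sphere_area R]_(e in @S2 R) (Num.max (net_descent P e q) 0)%:E)%E.
Proof.
rewrite /ntc; congr (_ * _)%E; apply: eq_integral => e _.
congr (Num.max _ _)%:E; rewrite /net_descent big_seq [RHS]big_seq.
apply: eq_bigr => v; rewrite neighborsP => qvP.
by rewrite chi_normalize// (edge_neq qvP).
Qed.

Lemma NTC_integral P : NTC P = ((4^-1)%:E * \int[@sphere_area R]_(e in @S2 R)
  (\sum_(q <- vertices P) Num.max (net_descent P e q) 0)%:E)%E.
Proof.
have F0 q e : (0 <= (Num.max (net_descent P e q) 0)%:E)%E.
  by rewrite lee_fin le_max lexx orbT.
under eq_integral do rewrite -sumEFin.
rewrite ge0_integral_sum//; last 2 first.
- exact: measurable_S2.
- by move=> q; apply/measurable_EFinP; exact: measurable_net_descent.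
rewrite ge0_sume_distrr; last by move=> q _; exact: integral_ge0.
by apply: eq_bigr => q _; rewrite ntcE.
Qed.

End Genericity.

(** * The comparison of multiplicities and of net total curvatures *)

(** A vertex of P' that is not a vertex of P is not topological for P, hence not for
    P', so its degree is 2. *)
Lemma homeomorphism_subdivides (R : realType) (P P' : polygonal_graph R)
    (h : {ptws R3 R -> R} -> {ptws R3 R -> R}) :
  topological_vertices P' = topological_vertices P -> refinement P' P ->
  homeomorphism (realization P) (realization P') h ->
  (forall q, q \in vertices P -> h (vertex_point q) = vertex_point q) ->
  exists on_edge first, subdivides P P' on_edge first.
Proof.
move=> topE sub [[h_real h_inj h_surj] hc [g gc hgK]] hV.
have hK w : realization P w -> g (h w) = w by move=> wP; rewrite hgK ?inE.
have g_real z : realization P' z -> realization P (g z).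
  by move=> /h_surj[w wP <-]; rewrite hK.
have gK z : realization P' z -> h (g z) = z.
  by move=> /h_surj[w wP <-]; rewrite hK.
have [first firstP] := first_vertices h_real g_real hK gK hc gc hV.
exists (on_edge g), first; split => //.
- move=> q qP' qP; have : q \notin topological_vertices P' by rewrite topE !inE (negPf qP).
  by rewrite !inE qP' /= negbK => /eqP.
- by move=> u /firstP[].
- move=> u v uvP; have [uP _] := edge_vertices uvP.
  by have [_] := firstP u uP; apply; rewrite neighborsP.
- move=> u v q uvP; exact: (on_edge_vertex hK hV (edge_neq uvP)).
- move=> u v q n; exact: (on_edge_neighbor g_real gK gc hV).
- move=> u v u' v' q; exact: (on_edge_unique g_real gK hV).
Qed.

Theorem proposition2 (R : realType) (P P' : polygonal_graph R)
    (same_topological_vertices : topological_vertices P' = topological_vertices P)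
    (refine : refinement P' P)
    (homeo : exists2 h : {ptws R3 R -> R} -> {ptws R3 R -> R},
       homeomorphism (realization P) (realization P') h &
       forall q, q \in vertices P -> h (vertex_point q) = vertex_point q) :
  {ae @sphere_area R, forall e, S2 e -> forall M M',
     parameterization P M -> parameterization P' M' ->
     multiplicity P M e <= multiplicity P' M' e} /\
  (NTC P <= NTC P')%E.
Proof.
have [h h_homeo hV] := homeo.
have [on_e [first sub]] :=
  homeomorphism_subdivides same_topological_vertices refine h_homeo hV.
have sep := @ae_separates R (vertices P'); split.
  apply: filterS sep => e sep _ M M' PM PM'.
  have multiplicityE Q N : (vertices Q `<=` vertices P')%fset ->
      parameterization Q N -> multiplicity Q N e =
      (\sum_(q <- vertices Q) Num.max (net_descent Q e q) 0) / 2.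
    move=> QP' QN; rewrite /multiplicity mulr_suml; apply: eq_bigr => q _.
    rewrite (nlm_parameterization q QN); last first.
      by move=> x y; exact: separates_edge QP' sep.
    by rewrite maxr_pMl// mul0r.
  rewrite (multiplicityE P)// (multiplicityE P')// ler_pM2r ?invr_gt0//.
  exact: sum_net_descent_subdivision sub sep.
rewrite !NTC_integral; apply: lee_wpmul2l; first by rewrite lee_fin invr_ge0.
have sum_ge0 Q e : (0 <= (\sum_(q <- vertices Q)
    Num.max (net_descent Q e q) 0 : R)%:E)%E.
  by rewrite lee_fin; apply: sumr_ge0 => q _; rewrite le_max lexx orbT.
have sum_meas (Q : polygonal_graph R) : measurable_fun (@S2 R) (fun e =>
    (\sum_(q <- vertices Q) Num.max (net_descent Q e q) 0)%:E).
  apply/measurable_EFinP; apply: measurable_sum => q; exact: measurable_net_descent.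
apply: ae_ge0_le_integral => //; first exact: measurable_S2.
apply: filterS sep => e sep _; rewrite lee_fin.
exact: sum_net_descent_subdivision sub sep.
Qed.
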